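(* Let $A$ be a Novikov algebra over $F$ and let $M$ be an irreducible right Novikov $A$-module. Then one of the following holds: (1) the module $M$ is associative, and $M$ is isomorphic (as an $A$-module) to the quotient module $A/I$ for some maximal two-sided ideal $I$ of $A$ such that the algebra $A/I$ is a field; (2) the module $M$ is not associative, and $M$ is isomorphic (as an $A$-module) to the quotient module $A/I$ for some maximal right ideal $I$ of $A$ for which there exist elements $e,f\in A$ such that $a-(a,e,f)\in I$ for every $a\in A$. Moreover, the element $e$ is determined by (that is, is chosen depending on) the element $f$, and for $f$ one can take any element of $A$ such that $(A,A,f)\not\subseteq I$; that is, for every $f\in A$ with $(A,A,f)\not\subseteq I$ there is $e\in A$ such that $a-(a,e,f)\in I$ for every $a\in A$.
   Context: $F$ is a field of characteristic different from $2$; all algebras are (not necessarily associative or unital) algebras over $F$. Write $(x,y,z)=(xy)z-x(yz)$. An algebra is a Novikov algebra if it satisfies the identities $(x,y,z)=(y,x,z)$ and $(xy)z=(xz)y$. Ideals (right or two-sided) are in particular subspaces; a maximal (right) ideal is a proper (right) ideal maximal among proper (right) ideals. Right modules. Let $\mathcal N_X$ be the free Novikov algebra over $F$ on countably many generators $X=\{x_1,x_2,\dots\}$. For a vector space $V$ let $T(V)$ be its tensor algebra; a linear map $\varphi:V\to B$ to a unital associative algebra $B$ induces the homomorphism $T(\varphi):T(V)\to B$, $1\mapsto 1$, $v_1\otimes\dots\otimes v_n\mapsto\varphi(v_1)\cdots\varphi(v_n)$. Endomorphisms act on the right: $m(\alpha\beta)=(m\alpha)\beta$. Let $R:\mathcal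 N_X\to\mathrm{End}(\mathcal N_X)$, $R(f)=R_f$, $gR_f=gf$. Elements of the kernel of $T(R):T(\mathcal N_X)\to\mathrm{End}(\mathcal N_X)$ are called R-identities. For $G(x_1,\dots,x_n)\in T(\mathcal N_X)$ and $a_1,\dots,a_n$ in a Novikov algebra $A$, $G(a_1,\dots,a_n)\in T(A)$ is obtained by substituting $a_i$ for $x_i$. A right (Novikov) representation of $A$ is a linear map $\rho:A\to\mathrm{End}(M)$, $M$ a vector space, such that $T(\rho)(G(a_1,\dots,a_n))=0$ for every R-identity $G$ and all $a_i\in A$. The space $M$ with the action $m\cdot a=m\rho(a)$ is then called a right (Novikov) $A$-module. For a right ideal $I$ of $A$, the quotient $A/I$ with $(x+I)\cdot a=xa+I$ is a right Novikov $A$-module (the quotient module). A right $A$-module $M$ is irreducible if it has no nonzero proper submodules and $MA\neq 0$. It is associative if $(m,a,b):=(m\cdot a)\cdot b-m\cdot(ab)=0$ for all $m\in M$, $a,b\in A$. For $f\in A$, $(A,A,f)$ denotes the span of all $(a,b,f)$, $a,b\in A$. *)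

(* Defs.v *)
From HB Require Import structures.
From mathcomp Require Import all_boot all_algebra.
From mathcomp Require Import boolp.

Set Implicit Arguments.
Unset Strict Implicit.
Unset Printing Implicit Defensive.

Import GRing.Theory.
Local Open Scope ring_scope.
Local Open Scope quotient_scope.

HB.mixin Record Lmodule_isNAAlgebra (F : fieldType) A of GRing.Lmodule F A := {
  namul : A -> A -> A;
  namulDl : left_distributive namul +%R;
  namulDr : right_distributive namul +%R;
  namulZl : forall (c : F) (x y : A), namul (c *: x) y = c *: namul x y;
  namulZr : forall (c : F) (x y : A), namul x (c *: y) = c *: namul x y
}.
#[short(type="naAlgType")]
HB.structure Definition NAAlgebra (F : fieldType) :=
  {A of GRing.Lmodule F A & Lmodule_isNAAlgebra F A}.

Notation "x ** y" := (namul x y) (at level 40, left associativity) : ring_scope.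

Definition associator (F : fieldType) (A : naAlgType F) (x y z : A) : A :=
  (x ** y) ** z - x ** (y ** z).

HB.mixin Record NAAlgebra_isNovikov (F : fieldType) A of NAAlgebra F A := {
  novikov_lsym : forall x y z : A, associator x y z = associator y x z;
  novikov_rcomm : forall x y z : A, (x ** y) ** z = (x ** z) ** y
}.
#[short(type="novikovType")]
HB.structure Definition Novikov (F : fieldType) :=
  {A of NAAlgebra F A & NAAlgebra_isNovikov F A}.

Definition is_field (F : fieldType) (A : naAlgType F) : Prop :=
  [/\ commutative (@namul F A), associative (@namul F A) &
      exists u : A, [/\ u <> 0, left_id u (@namul F A) &
                        forall x : A, x <> 0 -> exists y : A, x ** y = u]].

(* Unital associative algebras. The library's [algType] would not do: it
   excludes the zero algebra, hence the endomorphisms of the zero space. *)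
HB.mixin Record NAAlgebra_isUnitalAssoc (F : fieldType) B of NAAlgebra F B := {
  uaone : B;
  uamulA : associative (@namul F B);
  uamul1l : left_id uaone (@namul F B);
  uamul1r : right_id uaone (@namul F B)
}.
#[short(type="uaAlgType")]
HB.structure Definition UAAlgebra (F : fieldType) :=
  {B of NAAlgebra F B & NAAlgebra_isUnitalAssoc F B}.

Definition endo (F : fieldType) (M : lmodType F) : Type := {linear M -> M}.

Section Endo.
Variables (F : fieldType) (M : lmodType F).
Implicit Types f g h : endo M.

Definition ract (m : M) f : M := (f : {linear M -> M}) m.

Lemma endoP f g : (forall m, ract m f = ract m g) -> f = g.
Proof.
rewrite /ract; case: f g => [f fc] [g gc] /= /funext E.
by subst g; congr GRing.Linear.Pack; case: fc gc => [[p] [q]] [[r] [s]];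
   rewrite (Prop_irrelevance p r) (Prop_irrelevance q s).
Qed.

HB.instance Definition _ := gen_eqMixin (endo M).
HB.instance Definition _ := gen_choiceMixin (endo M).

Definition endo0 : endo M := \0 : {linear M -> M}.
Definition endo1 : endo M := idfun : {linear M -> M}.
Definition endoN f : endo M := \- (f : {linear M -> M}) : {linear M -> M}.
Definition endoD f g : endo M :=
  (f : {linear M -> M}) \+ (g : {linear M -> M}) : {linear M -> M}.
Definition endoZ (c : F) f : endo M := c \*: (f : {linear M -> M}) : {linear M -> M}.
(* The product [endoM f g] applies [f] first. *)
Definition endoM f g : endo M :=
  (g : {linear M -> M}) \o (f : {linear M -> M}) : {linear M -> M}.

Lemma endoDA : associative endoD.
Proof. by move=> f g h; apply: endoP => m; apply: addrA. Qed.
Lemma endoDC : commutative endoD.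
Proof. by move=> f g; apply: endoP => m; apply: addrC. Qed.
Lemma endo0D : left_id endo0 endoD.
Proof. by move=> f; apply: endoP => m; apply: add0r. Qed.
Lemma endoND : left_inverse endo0 endoN endoD.
Proof. by move=> f; apply: endoP => m; apply: addNr. Qed.

HB.instance Definition _ :=
  GRing.isZmodule.Build (endo M) endoDA endoDC endo0D endoND.

Lemma endoZA (a b : F) f : endoZ a (endoZ b f) = endoZ (a * b) f.
Proof. by apply: endoP => m; apply: scalerA. Qed.
Lemma endo1Z : left_id 1 endoZ.
Proof. by move=> f; apply: endoP => m; apply: scale1r. Qed.
Lemma endoZDr : right_distributive endoZ +%R.
Proof. by move=> c f g; apply: endoP => m; apply: scalerDr. Qed.
Lemma endoZDl f : {morph endoZ^~ f : a b / a + b}.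
Proof. by move=> a b; apply: endoP => m; apply: scalerDl. Qed.

HB.instance Definition _ :=
  GRing.Zmodule_isLmodule.Build F (endo M) endoZA endo1Z endoZDr endoZDl.

Lemma endoMDl : left_distributive endoM +%R.
Proof. by move=> f g h; apply: endoP => m; apply: (linearD (h : {linear M -> M})). Qed.
Lemma endoMDr : right_distributive endoM +%R.
Proof. by move=> f g h; apply: endoP. Qed.
Lemma endoMZl (c : F) f g : endoM (c *: f) g = c *: endoM f g.
Proof. by apply: endoP => m; apply: (linearZZ (g : {linear M -> M})). Qed.
Lemma endoMZr (c : F) f g : endoM f (c *: g) = c *: endoM f g.
Proof. by apply: endoP. Qed.

HB.instance Definition _ :=
  Lmodule_isNAAlgebra.Build F (endo M) endoMDl endoMDr endoMZl endoMZr.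

Lemma endoMA : associative (@namul F (endo M)).
Proof. by move=> f g h; apply: endoP. Qed.
Lemma endo1M : left_id endo1 (@namul F (endo M)).
Proof. by move=> f; apply: endoP. Qed.
Lemma endoM1 : right_id endo1 (@namul F (endo M)).
Proof. by move=> f; apply: endoP. Qed.

HB.instance Definition _ :=
  NAAlgebra_isUnitalAssoc.Build F (endo M) endoMA endo1M endoM1.

Lemma ractDl m n f : ract (m + n) f = ract m f + ract n f.
Proof. exact: (linearD (f : {linear M -> M})). Qed.
Lemma ractZl c m f : ract (c *: m) f = c *: ract m f.
Proof. exact: (linearZZ (f : {linear M -> M})). Qed.
Lemma ract0r m : ract m 0 = 0. Proof. by []. Qed.
Lemma ractDr m f g : ract m (f + g) = ract m f + ract m g. Proof. by []. Qed.
Lemma ractZr c m f : ract m (c *: f) = c *: ract m f. Proof. by []. Qed.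
Lemma ractM m f g : ract m (f ** g) = ract (ract m f) g. Proof. by []. Qed.
Lemma ract1 m : ract m uaone = m. Proof. by []. Qed.

End Endo.

(* The free Novikov algebra on [x_0, x_1, ...], as terms modulo the least
   congruence containing the axioms. *)

Section FreeNovikov.
Variable F : fieldType.

Inductive nterm : Type :=
| NVar of nat
| NZero
| NAdd of nterm & nterm
| NScale of F & nterm
| NMul of nterm & nterm.

Definition NAssoc (s t u : nterm) : nterm :=
  NAdd (NMul (NMul s t) u) (NScale (-1) (NMul s (NMul t u))).

Inductive neq : nterm -> nterm -> Prop :=
| neq_refl t : neq t t
| neq_sym s t : neq s t -> neq t s
| neq_trans s t u : neq s t -> neq t u -> neq s u
| neq_add s s' t t' : neq s s' -> neq t t' -> neq (NAdd s t) (NAdd s' t')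
| neq_scale c s s' : neq s s' -> neq (NScale c s) (NScale c s')
| neq_mul s s' t t' : neq s s' -> neq t t' -> neq (NMul s t) (NMul s' t')
| neq_addA s t u : neq (NAdd s (NAdd t u)) (NAdd (NAdd s t) u)
| neq_addC s t : neq (NAdd s t) (NAdd t s)
| neq_add0 s : neq (NAdd NZero s) s
| neq_scaleA a b s : neq (NScale a (NScale b s)) (NScale (a * b) s)
| neq_scale0 s : neq (NScale 0 s) NZero
| neq_scale1 s : neq (NScale 1 s) s
| neq_scaleDr c s t : neq (NScale c (NAdd s t)) (NAdd (NScale c s) (NScale c t))
| neq_scaleDl a b s : neq (NScale (a + b) s) (NAdd (NScale a s) (NScale b s))
| neq_mulDl s t u : neq (NMul (NAdd s t) u) (NAdd (NMul s u) (NMul t u))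
| neq_mulDr s t u : neq (NMul s (NAdd t u)) (NAdd (NMul s t) (NMul s u))
| neq_mulZl c s t : neq (NMul (NScale c s) t) (NScale c (NMul s t))
| neq_mulZr c s t : neq (NMul s (NScale c t)) (NScale c (NMul s t))
| neq_lsym s t u : neq (NAssoc s t u) (NAssoc t s u)
| neq_rcomm s t u : neq (NMul (NMul s t) u) (NMul (NMul s u) t).

HB.instance Definition _ := gen_eqMixin nterm.
HB.instance Definition _ := gen_choiceMixin nterm.

Definition neqb (s t : nterm) : bool := `[< neq s t >].

Lemma neqb_equiv : equiv_class_of neqb.
Proof.
split=> [x|x y|y x z]; first by apply/asboolP; apply: neq_refl.
  by apply/asboolP/asboolP; apply: neq_sym.
by move=> /asboolP xy /asboolP yz; apply/asboolP; apply: neq_trans xy yz.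
Qed.
Canonical neqb_equiv_rel := EquivRelPack neqb_equiv.

Definition freeNovikov : Type := {eq_quot neqb}.

HB.instance Definition _ := Choice.on freeNovikov.
HB.instance Definition _ := EqQuotient.on freeNovikov.

Local Notation N := freeNovikov.

Lemma fn_piP s t : \pi_N s = \pi_N t <-> neq s t.
Proof. by split=> [/eqmodP/asboolP|st]//; apply/eqmodP/asboolP. Qed.

Lemma fn_repr s : neq (repr (\pi_N s)) s.
Proof. by apply/fn_piP; rewrite reprK. Qed.

Definition fn_var (i : nat) : N := \pi_N (NVar i).
Definition fn_zero : N := \pi_N NZero.
Definition fn_add (x y : N) : N := \pi_N (NAdd (repr x) (repr y)).
Definition fn_scale (c : F) (x : N) : N := \pi_N (NScale c (repr x)).
Definition fn_mul (x y : N) : N := \pi_N (NMul (repr x) (repr y)).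

Lemma fn_piD s t : \pi_N (NAdd s t) = fn_add (\pi_N s) (\pi_N t).
Proof. by apply/fn_piP; apply: neq_add; apply/neq_sym/fn_repr. Qed.
Lemma fn_piZ c s : \pi_N (NScale c s) = fn_scale c (\pi_N s).
Proof. by apply/fn_piP; apply: neq_scale; apply/neq_sym/fn_repr. Qed.
Lemma fn_piM s t : \pi_N (NMul s t) = fn_mul (\pi_N s) (\pi_N t).
Proof. by apply/fn_piP; apply: neq_mul; apply/neq_sym/fn_repr. Qed.

Let fnE := (fn_piD, fn_piZ, fn_piM).

Lemma fn_addA : associative fn_add.
Proof.
elim/quotW=> s; elim/quotW=> t; elim/quotW=> u.
by have /fn_piP := neq_addA s t u; rewrite !fnE.
Qed.
Lemma fn_addC : commutative fn_add.
Proof.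
elim/quotW=> s; elim/quotW=> t.
by have /fn_piP := neq_addC s t; rewrite !fnE.
Qed.
Lemma fn_add0 : left_id fn_zero fn_add.
Proof.
elim/quotW=> s.
by have /fn_piP := neq_add0 s; rewrite !fnE.
Qed.
Lemma fn_scaleA a b x : fn_scale a (fn_scale b x) = fn_scale (a * b) x.
Proof.
elim/quotW: x => s.
by have /fn_piP := neq_scaleA a b s; rewrite !fnE.
Qed.
Lemma fn_scale0 x : fn_scale 0 x = fn_zero.
Proof.
elim/quotW: x => s.
by have /fn_piP := neq_scale0 s; rewrite !fnE.
Qed.
Lemma fn_scale1 : left_id 1 fn_scale.
Proof.
elim/quotW=> s.
by have /fn_piP := neq_scale1 s; rewrite !fnE.
Qed.
Lemma fn_scaleDr : right_distributive fn_scale fn_add.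
Proof.
move=> c; elim/quotW=> s; elim/quotW=> t.
by have /fn_piP := neq_scaleDr c s t; rewrite !fnE.
Qed.
Lemma fn_scaleDl x a b : fn_scale (a + b) x = fn_add (fn_scale a x) (fn_scale b x).
Proof.
elim/quotW: x => s.
by have /fn_piP := neq_scaleDl a b s; rewrite !fnE.
Qed.

HB.instance Definition _ := GRing.isNmodule.Build N fn_addA fn_addC fn_add0.
HB.instance Definition _ := GRing.Nmodule_isLSemiModule.Build F N
  fn_scaleA fn_scale0 fn_scale1 fn_scaleDr fn_scaleDl.
HB.instance Definition _ := GRing.LSemiModule_isLmodule.Build F N.

Lemma fn_mulDl : left_distributive fn_mul +%R.
Proof.
elim/quotW=> s; elim/quotW=> t; elim/quotW=> u.
by have /fn_piP := neq_mulDl s t u; rewrite !fnE.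
Qed.
Lemma fn_mulDr : right_distributive fn_mul +%R.
Proof.
elim/quotW=> s; elim/quotW=> t; elim/quotW=> u.
by have /fn_piP := neq_mulDr s t u; rewrite !fnE.
Qed.
Lemma fn_mulZl (c : F) (x y : N) : fn_mul (c *: x) y = c *: fn_mul x y.
Proof.
elim/quotW: x => s; elim/quotW: y => t.
by have /fn_piP := neq_mulZl c s t; rewrite !fnE.
Qed.
Lemma fn_mulZr (c : F) (x y : N) : fn_mul x (c *: y) = c *: fn_mul x y.
Proof.
elim/quotW: x => s; elim/quotW: y => t.
by have /fn_piP := neq_mulZr c s t; rewrite !fnE.
Qed.

HB.instance Definition _ :=
  Lmodule_isNAAlgebra.Build F N fn_mulDl fn_mulDr fn_mulZl fn_mulZr.

Lemma fn_piassoc s t u : \pi_N (NAssoc s t u) = associator (\pi_N s) (\pi_N t) (\pi_N u).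
Proof. by rewrite /associator -scaleN1r /NAssoc !fnE. Qed.
Lemma fn_lsym (x y z : N) : associator x y z = associator y x z.
Proof.
elim/quotW: x => s; elim/quotW: y => t; elim/quotW: z => u.
by have /fn_piP := neq_lsym s t u; rewrite !fn_piassoc.
Qed.
Lemma fn_rcomm (x y z : N) : (x ** y) ** z = (x ** z) ** y.
Proof.
elim/quotW: x => s; elim/quotW: y => t; elim/quotW: z => u.
by have /fn_piP := neq_rcomm s t u; rewrite !fnE.
Qed.

HB.instance Definition _ := NAAlgebra_isNovikov.Build F N fn_lsym fn_rcomm.

Lemma fn_ind (P : N -> Prop) :
  (forall i, P (fn_var i)) -> P 0 -> (forall x y, P x -> P y -> P (x + y)) ->
  (forall c x, P x -> P (c *: x)) -> (forall x y, P x -> P y -> P (x ** y)) ->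
  forall x, P x.
Proof.
move=> PX P0 PD PZ PM; elim/quotW; elim=> [i||s Ps t Pt|c s Ps|s Ps t Pt].
- exact: PX.
- exact: P0.
- by rewrite fn_piD; apply: PD.
- by rewrite fn_piZ; apply: PZ.
- by rewrite fn_piM; apply: PM.
Qed.

Section Substitution.
Variables (A : novikovType F) (a : nat -> A).

Fixpoint nterm_eval (t : nterm) : A :=
  match t with
  | NVar i => a i
  | NZero => 0
  | NAdd s t => nterm_eval s + nterm_eval t
  | NScale c s => c *: nterm_eval s
  | NMul s t => nterm_eval s ** nterm_eval t
  end.

Lemma nterm_eval_eq s t : neq s t -> nterm_eval s = nterm_eval t.
Proof.
elim=> {s t} //=.
- by move=> s t u _ -> _ ->.
- by move=> s s' t t' _ -> _ ->.
- by move=> c s s' _ ->.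
- by move=> s s' t t' _ -> _ ->.
- by move=> *; apply: addrA.
- by move=> *; apply: addrC.
- by move=> *; apply: add0r.
- by move=> *; apply: scalerA.
- by move=> *; apply: scale0r.
- by move=> *; apply: scale1r.
- by move=> *; apply: scalerDr.
- by move=> *; apply: scalerDl.
- by move=> *; apply: namulDl.
- by move=> *; apply: namulDr.
- by move=> *; apply: namulZl.
- by move=> *; apply: namulZr.
- by move=> *; rewrite !scaleN1r; apply: novikov_lsym.
- by move=> *; apply: novikov_rcomm.
Qed.

Definition fn_subst (x : N) : A := nterm_eval (repr x).

Lemma fn_subst_pi s : fn_subst (\pi_N s) = nterm_eval s.
Proof. exact/nterm_eval_eq/fn_repr. Qed.
Lemma fn_subst_var i : fn_subst (fn_var i) = a i.
Proof. exact: fn_subst_pi. Qed.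
Lemma fn_subst_linear : linear fn_subst.
Proof.
move=> c; elim/quotW=> s; elim/quotW=> t.
have -> : c *: \pi_N s + \pi_N t = \pi_N (NAdd (NScale c s) t) by rewrite !fnE.
by rewrite !fn_subst_pi.
Qed.
Lemma fn_substM : {morph fn_subst : x y / x ** y}.
Proof.
elim/quotW=> s; elim/quotW=> t.
have -> : \pi_N s ** \pi_N t = \pi_N (NMul s t) by rewrite fnE.
by rewrite !fn_subst_pi.
Qed.

HB.instance Definition _ := GRing.isLinear.Build F N A *:%R fn_subst fn_subst_linear.

Lemma fn_subst0 : fn_subst 0 = 0. Proof. exact: linear0. Qed.
Lemma fn_substD : {morph fn_subst : x y / x + y}. Proof. exact: linearD. Qed.
Lemma fn_substZ c : {morph fn_subst : x / c *: x}. Proof. exact: linearZZ. Qed.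

End Substitution.

End FreeNovikov.

Arguments fn_var {F} i.
Arguments fn_subst {F A} a x.

(* The tensor algebra of a vector space, presented as the unital associative
   algebra generated by [V], subject only to the linearity of the inclusion
   of [V]. *)

Section TensorAlgebra.
Variables (F : fieldType) (V : lmodType F).

Inductive tterm : Type :=
| TIn of V
| TOne
| TZero
| TAdd of tterm & tterm
| TScale of F & tterm
| TMul of tterm & tterm.

Inductive teq : tterm -> tterm -> Prop :=
| teq_refl t : teq t t
| teq_sym s t : teq s t -> teq t s
| teq_trans s t u : teq s t -> teq t u -> teq s u
| teq_add s s' t t' : teq s s' -> teq t t' -> teq (TAdd s t) (TAdd s' t')
| teq_scale c s s' : teq s s' -> teq (TScale c s) (TScale c s')
| teq_mul s s' t t' : teq s s' -> teq t t' -> teq (TMul s t) (TMul s' t')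
| teq_addA s t u : teq (TAdd s (TAdd t u)) (TAdd (TAdd s t) u)
| teq_addC s t : teq (TAdd s t) (TAdd t s)
| teq_add0 s : teq (TAdd TZero s) s
| teq_scaleA a b s : teq (TScale a (TScale b s)) (TScale (a * b) s)
| teq_scale0 s : teq (TScale 0 s) TZero
| teq_scale1 s : teq (TScale 1 s) s
| teq_scaleDr c s t : teq (TScale c (TAdd s t)) (TAdd (TScale c s) (TScale c t))
| teq_scaleDl a b s : teq (TScale (a + b) s) (TAdd (TScale a s) (TScale b s))
| teq_mulDl s t u : teq (TMul (TAdd s t) u) (TAdd (TMul s u) (TMul t u))
| teq_mulDr s t u : teq (TMul s (TAdd t u)) (TAdd (TMul s t) (TMul s u))
| teq_mulZl c s t : teq (TMul (TScale c s) t) (TScale c (TMul s t))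
| teq_mulZr c s t : teq (TMul s (TScale c t)) (TScale c (TMul s t))
| teq_mulA s t u : teq (TMul s (TMul t u)) (TMul (TMul s t) u)
| teq_mul1l s : teq (TMul TOne s) s
| teq_mul1r s : teq (TMul s TOne) s
| teq_inD v w : teq (TIn (v + w)) (TAdd (TIn v) (TIn w))
| teq_inZ c v : teq (TIn (c *: v)) (TScale c (TIn v)).

HB.instance Definition _ := gen_eqMixin tterm.
HB.instance Definition _ := gen_choiceMixin tterm.

Definition teqb (s t : tterm) : bool := `[< teq s t >].

Lemma teqb_equiv : equiv_class_of teqb.
Proof.
split=> [x|x y|y x z]; first by apply/asboolP; apply: teq_refl.
  by apply/asboolP/asboolP; apply: teq_sym.
by move=> /asboolP xy /asboolP yz; apply/asboolP; apply: teq_trans xy yz.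
Qed.
Canonical teqb_equiv_rel := EquivRelPack teqb_equiv.

Definition tensorAlg : Type := {eq_quot teqb}.

HB.instance Definition _ := Choice.on tensorAlg.
HB.instance Definition _ := EqQuotient.on tensorAlg.

Local Notation T := tensorAlg.

Lemma ta_piP s t : \pi_T s = \pi_T t <-> teq s t.
Proof. by split=> [/eqmodP/asboolP|st]//; apply/eqmodP/asboolP. Qed.

Lemma ta_repr s : teq (repr (\pi_T s)) s.
Proof. by apply/ta_piP; rewrite reprK. Qed.

Definition ta_in (v : V) : T := \pi_T (TIn v).
Definition ta_one : T := \pi_T TOne.
Definition ta_zero : T := \pi_T TZero.
Definition ta_add (x y : T) : T := \pi_T (TAdd (repr x) (repr y)).
Definition ta_scale (c : F) (x : T) : T := \pi_T (TScale c (repr x)).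
Definition ta_mul (x y : T) : T := \pi_T (TMul (repr x) (repr y)).

Lemma ta_piD s t : \pi_T (TAdd s t) = ta_add (\pi_T s) (\pi_T t).
Proof. by apply/ta_piP; apply: teq_add; apply/teq_sym/ta_repr. Qed.
Lemma ta_piZ c s : \pi_T (TScale c s) = ta_scale c (\pi_T s).
Proof. by apply/ta_piP; apply: teq_scale; apply/teq_sym/ta_repr. Qed.
Lemma ta_piM s t : \pi_T (TMul s t) = ta_mul (\pi_T s) (\pi_T t).
Proof. by apply/ta_piP; apply: teq_mul; apply/teq_sym/ta_repr. Qed.

Let taE := (ta_piD, ta_piZ, ta_piM).

Lemma ta_addA : associative ta_add.
Proof.
elim/quotW=> s; elim/quotW=> t; elim/quotW=> u.
by have /ta_piP := teq_addA s t u; rewrite !taE.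
Qed.
Lemma ta_addC : commutative ta_add.
Proof.
elim/quotW=> s; elim/quotW=> t.
by have /ta_piP := teq_addC s t; rewrite !taE.
Qed.
Lemma ta_add0 : left_id ta_zero ta_add.
Proof.
elim/quotW=> s.
by have /ta_piP := teq_add0 s; rewrite !taE.
Qed.
Lemma ta_scaleA a b x : ta_scale a (ta_scale b x) = ta_scale (a * b) x.
Proof.
elim/quotW: x => s.
by have /ta_piP := teq_scaleA a b s; rewrite !taE.
Qed.
Lemma ta_scale0 x : ta_scale 0 x = ta_zero.
Proof.
elim/quotW: x => s.
by have /ta_piP := teq_scale0 s; rewrite !taE.
Qed.
Lemma ta_scale1 : left_id 1 ta_scale.
Proof.
elim/quotW=> s.
by have /ta_piP := teq_scale1 s; rewrite !taE.
Qed.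
Lemma ta_scaleDr : right_distributive ta_scale ta_add.
Proof.
move=> c; elim/quotW=> s; elim/quotW=> t.
by have /ta_piP := teq_scaleDr c s t; rewrite !taE.
Qed.
Lemma ta_scaleDl x a b : ta_scale (a + b) x = ta_add (ta_scale a x) (ta_scale b x).
Proof.
elim/quotW: x => s.
by have /ta_piP := teq_scaleDl a b s; rewrite !taE.
Qed.

HB.instance Definition _ := GRing.isNmodule.Build T ta_addA ta_addC ta_add0.
HB.instance Definition _ := GRing.Nmodule_isLSemiModule.Build F T
  ta_scaleA ta_scale0 ta_scale1 ta_scaleDr ta_scaleDl.
HB.instance Definition _ := GRing.LSemiModule_isLmodule.Build F T.

Lemma ta_mulDl : left_distributive ta_mul +%R.
Proof.
elim/quotW=> s; elim/quotW=> t; elim/quotW=> u.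
by have /ta_piP := teq_mulDl s t u; rewrite !taE.
Qed.
Lemma ta_mulDr : right_distributive ta_mul +%R.
Proof.
elim/quotW=> s; elim/quotW=> t; elim/quotW=> u.
by have /ta_piP := teq_mulDr s t u; rewrite !taE.
Qed.
Lemma ta_mulZl (c : F) (x y : T) : ta_mul (c *: x) y = c *: ta_mul x y.
Proof.
elim/quotW: x => s; elim/quotW: y => t.
by have /ta_piP := teq_mulZl c s t; rewrite !taE.
Qed.
Lemma ta_mulZr (c : F) (x y : T) : ta_mul x (c *: y) = c *: ta_mul x y.
Proof.
elim/quotW: x => s; elim/quotW: y => t.
by have /ta_piP := teq_mulZr c s t; rewrite !taE.
Qed.

HB.instance Definition _ :=
  Lmodule_isNAAlgebra.Build F T ta_mulDl ta_mulDr ta_mulZl ta_mulZr.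

Lemma ta_mulA : associative (@namul F T).
Proof.
elim/quotW=> s; elim/quotW=> t; elim/quotW=> u.
by have /ta_piP := teq_mulA s t u; rewrite !taE.
Qed.
Lemma ta_mul1l : left_id ta_one (@namul F T).
Proof. by elim/quotW=> s; have /ta_piP := teq_mul1l s; rewrite !taE. Qed.
Lemma ta_mul1r : right_id ta_one (@namul F T).
Proof. by elim/quotW=> s; have /ta_piP := teq_mul1r s; rewrite !taE. Qed.

HB.instance Definition _ :=
  NAAlgebra_isUnitalAssoc.Build F T ta_mulA ta_mul1l ta_mul1r.

Lemma ta_in_linear : linear ta_in.
Proof.
move=> c v w; rewrite /ta_in.
transitivity (\pi_T (TAdd (TScale c (TIn v)) (TIn w))); last by rewrite !taE.
apply/ta_piP/(teq_trans (teq_inD _ _))/teq_add; [exact: teq_inZ|exact: teq_refl].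
Qed.
HB.instance Definition _ := GRing.isLinear.Build F V T *:%R ta_in ta_in_linear.

Lemma ta_ind (P : T -> Prop) :
  (forall v, P (ta_in v)) -> P uaone -> P 0 -> (forall x y, P x -> P y -> P (x + y)) ->
  (forall c x, P x -> P (c *: x)) -> (forall x y, P x -> P y -> P (x ** y)) ->
  forall x, P x.
Proof.
move=> PI P1 P0 PD PZ PM; elim/quotW; elim=> [v|||s Ps t Pt|c s Ps|s Ps t Pt].
- exact: PI.
- exact: P1.
- exact: P0.
- by rewrite ta_piD; apply: PD.
- by rewrite ta_piZ; apply: PZ.
- by rewrite ta_piM; apply: PM.
Qed.

(* [ta_lift phi] is the homomorphism [T(phi)] induced by a linear map [phi]. *)

Section Lift.
Variables (B : uaAlgType F) (phi : {linear V -> B}).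

Fixpoint tterm_eval (t : tterm) : B :=
  match t with
  | TIn v => phi v
  | TOne => uaone
  | TZero => 0
  | TAdd s t => tterm_eval s + tterm_eval t
  | TScale c s => c *: tterm_eval s
  | TMul s t => tterm_eval s ** tterm_eval t
  end.

Lemma tterm_eval_eq s t : teq s t -> tterm_eval s = tterm_eval t.
Proof.
elim=> {s t} //=.
- by move=> s t u _ -> _ ->.
- by move=> s s' t t' _ -> _ ->.
- by move=> c s s' _ ->.
- by move=> s s' t t' _ -> _ ->.
- by move=> *; apply: addrA.
- by move=> *; apply: addrC.
- by move=> *; apply: add0r.
- by move=> *; apply: scalerA.
- by move=> *; apply: scale0r.
- by move=> *; apply: scale1r.
- by move=> *; apply: scalerDr.
- by move=> *; apply: scalerDl.
- by move=> *; apply: namulDl.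
- by move=> *; apply: namulDr.
- by move=> *; apply: namulZl.
- by move=> *; apply: namulZr.
- by move=> *; apply: uamulA.
- by move=> *; apply: uamul1l.
- by move=> *; apply: uamul1r.
- by move=> *; apply: linearD.
- by move=> *; apply: linearZZ.
Qed.

Definition ta_lift (x : T) : B := tterm_eval (repr x).

Lemma ta_lift_pi s : ta_lift (\pi_T s) = tterm_eval s.
Proof. exact/tterm_eval_eq/ta_repr. Qed.
Lemma ta_lift_in v : ta_lift (ta_in v) = phi v.
Proof. exact: ta_lift_pi. Qed.
Lemma ta_lift1 : ta_lift uaone = uaone.
Proof. exact: ta_lift_pi. Qed.
Lemma ta_lift_linear : linear ta_lift.
Proof.
move=> c; elim/quotW=> s; elim/quotW=> t.
have -> : c *: \pi_T s + \pi_T t = \pi_T (TAdd (TScale c s) t) by rewrite !taE.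
by rewrite !ta_lift_pi.
Qed.
Lemma ta_liftM : {morph ta_lift : x y / x ** y}.
Proof.
elim/quotW=> s; elim/quotW=> t.
have -> : \pi_T s ** \pi_T t = \pi_T (TMul s t) by rewrite taE.
by rewrite !ta_lift_pi.
Qed.

HB.instance Definition _ := GRing.isLinear.Build F T B *:%R ta_lift ta_lift_linear.

Lemma ta_lift0 : ta_lift 0 = 0. Proof. exact: linear0. Qed.
Lemma ta_liftD : {morph ta_lift : x y / x + y}. Proof. exact: linearD. Qed.
Lemma ta_liftZ c : {morph ta_lift : x / c *: x}. Proof. exact: linearZZ. Qed.

End Lift.

End TensorAlgebra.

Arguments ta_in {F V} v.
Arguments ta_lift {F V B} phi x.

Section RightMul.
Variables (F : fieldType) (A : naAlgType F).

Definition rmul_fun (f g : A) : A := g ** f.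

Lemma rmul_fun_linear (f : A) : linear (rmul_fun f).
Proof. by move=> c x y; rewrite /rmul_fun namulDl namulZl. Qed.
HB.instance Definition _ (f : A) :=
  GRing.isLinear.Build F A A *:%R (rmul_fun f) (rmul_fun_linear f).

(* The map [R : f |-> R_f], where [g R_f = g f]. *)
Definition rmul (f : A) : endo A := rmul_fun f : {linear A -> A}.

Lemma rmul_linear : linear rmul.
Proof. by move=> c x y; apply: endoP => g; rewrite /ract /= /rmul_fun namulDr namulZr. Qed.
HB.instance Definition _ := GRing.isLinear.Build F A (endo A) *:%R rmul rmul_linear.

End RightMul.

Arguments rmul {F A} f.

Definition R_identity (F : fieldType) (G : tensorAlg (freeNovikov F)) : Prop :=
  ta_lift rmul G = 0.

(* [G(a_1, ..., a_n)]. As [G] involves finitely many variables, substituting for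
   all of them at once is no restriction. *)
Definition ta_subst (F : fieldType) (A : novikovType F) (a : nat -> A)
    (G : tensorAlg (freeNovikov F)) : tensorAlg A :=
  ta_lift (ta_in \o fn_subst a : {linear freeNovikov F -> tensorAlg A}) G.

Definition right_representation (F : fieldType) (A : novikovType F)
    (M : lmodType F) (rho : {linear A -> endo M}) : Prop :=
  forall G : tensorAlg (freeNovikov F), R_identity G ->
  forall a : nat -> A, ta_lift rho (ta_subst a G) = 0.

Record rightModule (F : fieldType) (A : novikovType F) := RightModule {
  rmod_carrier :> lmodType F;
  rmod_rho : {linear A -> endo rmod_carrier};
  rmod_repr : right_representation rmod_rho
}.

Definition mact (F : fieldType) (A : novikovType F) (M : rightModule A)
  (m : M) (a : A) : M := ract m (rmod_rho M a).

Notation "m <.> a" := (mact m a) (at level 40, left associativity) : ring_scope.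

Definition irreducible_module (F : fieldType) (A : novikovType F)
    (M : rightModule A) : Prop :=
  (forall S : submodClosed M, (forall (m : M) (a : A), m \in S -> m <.> a \in S) ->
     (forall m : M, m \in S -> m = 0) \/ (forall m : M, m \in S))
  /\ exists (m : M) (a : A), m <.> a <> 0.

Definition associative_module (F : fieldType) (A : novikovType F)
    (M : rightModule A) : Prop :=
  forall (m : M) (a b : A), (m <.> a) <.> b - m <.> (a ** b) = 0.

Definition module_iso (F : fieldType) (A : novikovType F)
    (M N : rightModule A) : Prop :=
  exists2 phi : {linear M -> N}, bijective phi &
    forall (m : M) (a : A), phi (m <.> a) = phi m <.> a.

(* Ideals are boolean predicates; classically every subset is of this form. *)

HB.mixin Record isRightIdeal (F : fieldType) (A : naAlgType F) (S : {pred A}) := {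
  rideal_mul : forall x a : A, x \in S -> x ** a \in S
}.
#[short(type="rightIdeal")]
HB.structure Definition RightIdeal (F : fieldType) (A : naAlgType F) :=
  {S of @GRing.SubmodClosed F A S & isRightIdeal F A S}.

HB.mixin Record isLeftIdeal (F : fieldType) (A : naAlgType F) (S : {pred A}) := {
  lideal_mul : forall a x : A, x \in S -> a ** x \in S
}.
#[short(type="ideal")]
HB.structure Definition Ideal (F : fieldType) (A : naAlgType F) :=
  {S of @RightIdeal F A S & isLeftIdeal F A S}.

Definition maximal_right_ideal (F : fieldType) (A : naAlgType F)
    (I : rightIdeal A) : Prop :=
  (exists x : A, x \notin I) /\
  forall J : rightIdeal A, (exists x : A, x \notin J) ->
    {subset I <= J} -> {subset J <= I}.

Definition maximal_ideal (F : fieldType) (A : naAlgType F) (I : ideal A) : Prop :=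
  (exists x : A, x \notin I) /\
  forall J : ideal A, (exists x : A, x \notin J) ->
    {subset I <= J} -> {subset J <= I}.

Section QuotientSpace.
Variables (F : fieldType) (V : lmodType F) (W : submodClosed V).

(* Declares [W] as closed under opposite, which the library does not infer. *)
Definition submod_zmod : {pred V} := W.

Lemma submod_zmod_closed : zmod_closed submod_zmod.
Proof. exact: GRing.submod_closedB (submodClosedP W). Qed.
HB.instance Definition _ := GRing.isZmodClosed.Build V submod_zmod submod_zmod_closed.

Definition qspace : Type := Quotient.quot submod_zmod.

HB.instance Definition _ := GRing.Zmodule.on qspace.
HB.instance Definition _ := EqQuotient.on qspace.

Local Notation Q := qspace.

Lemma qs_piP x y : \pi_Q x = \pi_Q y <-> x - y \in W.
Proof.
have E : (x - y \in W) = (\pi_Q x == \pi_Q y) := Quotient.idealrBE submod_zmod x y.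
by rewrite E; split=> /eqP.
Qed.

Lemma qs_pi0 : \pi_Q 0 = 0.
Proof. exact: (@pi_zeror _ _ _ _ _ (Quotient.quot submod_zmod)). Qed.

Lemma qs_pi_eq0 x : \pi_Q x = 0 <-> x \in W.
Proof. by rewrite -[x in x \in W]subr0 -qs_pi0; apply: qs_piP. Qed.

Lemma qs_piD x y : \pi_Q (x + y) = \pi_Q x + \pi_Q y.
Proof. exact: (Quotient.pi_add submod_zmod). Qed.

Definition qs_scale (c : F) (x : Q) : Q := \pi_Q (c *: repr x).

Lemma qs_piZ c x : \pi_Q (c *: x) = qs_scale c (\pi_Q x).
Proof. by apply/qs_piP; rewrite -scalerBr; apply: rpredZ; apply/qs_piP; rewrite reprK. Qed.

Lemma qs_scaleA a b x : qs_scale a (qs_scale b x) = qs_scale (a * b) x.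
Proof.
elim/quotW: x => x.
by have := congr1 \pi_Q (scalerA a b x); rewrite !qs_piZ.
Qed.
Lemma qs_scale1 : left_id 1 qs_scale.
Proof.
elim/quotW=> x.
by have := congr1 \pi_Q (scale1r x); rewrite !qs_piZ.
Qed.
Lemma qs_scaleDr : right_distributive qs_scale +%R.
Proof.
move=> c; elim/quotW=> x; elim/quotW=> y.
by have := congr1 \pi_Q (scalerDr c x y); rewrite !(qs_piD, qs_piZ).
Qed.
Lemma qs_scaleDl x : {morph qs_scale^~ x : a b / a + b}.
Proof.
elim/quotW: x => x a b.
by have := congr1 \pi_Q (scalerDl x a b); rewrite !(qs_piD, qs_piZ).
Qed.

HB.instance Definition _ := GRing.Zmodule_isLmodule.Build F Q
  qs_scaleA qs_scale1 qs_scaleDr qs_scaleDl.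

Lemma qs_pi_linear : linear (\pi_Q : V -> Q).
Proof. by move=> c x y; rewrite qs_piD qs_piZ. Qed.

End QuotientSpace.

Section QuotientModule.
Variables (F : fieldType) (A : novikovType F) (I : rightIdeal A).
Local Notation Q := (qspace I).

Definition qm_act (a : A) (x : Q) : Q := \pi_Q (repr x ** a).

Lemma qm_actE a x : qm_act a (\pi_Q x) = \pi_Q (x ** a).
Proof.
apply/qs_piP.
have -> : repr (\pi_Q x) ** a - x ** a = (repr (\pi_Q x) - x) ** a.
  by rewrite namulDl -scaleN1r -namulZl scaleN1r.
by apply: rideal_mul; apply/qs_piP; rewrite reprK.
Qed.

Lemma qm_act_linear a : linear (qm_act a).
Proof.
move=> c; elim/quotW=> x; elim/quotW=> y.
by rewrite !qm_actE -!qs_pi_linear qm_actE namulDl namulZl.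
Qed.
HB.instance Definition _ (a : A) :=
  GRing.isLinear.Build F Q Q *:%R (qm_act a) (qm_act_linear a).

Definition qm_rho (a : A) : endo Q := qm_act a : {linear Q -> Q}.

Lemma qm_rho_linear : linear qm_rho.
Proof.
move=> c a b; apply: endoP; elim/quotW=> x.
by rewrite ractDr ractZr /ract /= !qm_actE -qs_pi_linear namulDr namulZr.
Qed.
HB.instance Definition _ := GRing.isLinear.Build F A (endo Q) *:%R qm_rho qm_rho_linear.

Lemma fn_subst_bound (x : freeNovikov F) : exists n : nat,
  forall a b : nat -> A, (forall i, (i < n)%N -> a i = b i) ->
  fn_subst a x = fn_subst b x.
Proof.
elim/fn_ind: x => [i||x y [m Hm] [n Hn]|c x [n Hn]|x y [m Hm] [n Hn]].
- by exists i.+1 => a b ab; rewrite !fn_subst_var ab.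
- by exists 0%N => a b _; rewrite !linear0.
- exists (maxn m n) => a b ab; rewrite !linearD.
  by congr (_ + _); [apply: Hm|apply: Hn] => i lti; apply: ab; rewrite leq_max lti ?orbT.
- by exists n => a b ab; rewrite !linearZ /= (Hn a b).
- exists (maxn m n) => a b ab; rewrite !fn_substM.
  by congr (_ ** _); [apply: Hm|apply: Hn] => i lti; apply: ab; rewrite leq_max lti ?orbT.
Qed.

Lemma ta_subst_bound (G : tensorAlg (freeNovikov F)) : exists n : nat,
  forall a b : nat -> A, (forall i, (i < n)%N -> a i = b i) ->
  ta_subst a G = ta_subst b G.
Proof.
rewrite /ta_subst.
elim/ta_ind: G => [x|||x y [m Hm] [n Hn]|c x [n Hn]|x y [m Hm] [n Hn]].
- have [n Hn] := fn_subst_bound x; exists n => a b ab.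
  by rewrite !ta_lift_in /= (Hn a b).
- by exists 0%N => a b _; rewrite !ta_lift1.
- by exists 0%N => a b _; rewrite !linear0.
- exists (maxn m n) => a b ab; rewrite !linearD.
  by congr (_ + _); [apply: Hm|apply: Hn] => i lti; apply: ab; rewrite leq_max lti ?orbT.
- by exists n => a b ab; rewrite !linearZ /= (Hn a b).
- exists (maxn m n) => a b ab; rewrite !ta_liftM.
  by congr (_ ** _); [apply: Hm|apply: Hn] => i lti; apply: ab; rewrite leq_max lti ?orbT.
Qed.

Lemma fn_subst_ract (a : nat -> A) (G : tensorAlg (freeNovikov F)) g :
  fn_subst a (ract g (ta_lift rmul G)) =
  ract (fn_subst a g) (ta_lift rmul (ta_subst a G)).
Proof.
rewrite /ta_subst.
elim/ta_ind: G g => [x|||x y Hx Hy|c x Hx|x y Hx Hy] g.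
- by rewrite !ta_lift_in; apply: fn_substM.
- by rewrite !ta_lift1.
- by rewrite !ta_lift0 !ract0r fn_subst0.
- by rewrite !ta_liftD !ractDr fn_substD Hx Hy.
- by rewrite !ta_liftZ !ractZr fn_substZ Hx.
- by rewrite !ta_liftM !ractM Hy Hx.
Qed.

Lemma qm_rho_ract (H : tensorAlg A) x :
  ract (\pi_Q x) (ta_lift qm_rho H) = \pi_Q (ract x (ta_lift rmul H)).
Proof.
elim/ta_ind: H x => [a|||G H HG HH|c G HG|G H HG HH] x.
- by rewrite !ta_lift_in; apply: qm_actE.
- by rewrite !ta_lift1.
- by rewrite !ta_lift0 !ract0r qs_pi0.
- by rewrite !ta_liftD !ractDr qs_piD HG HH.
- by rewrite !ta_liftZ !ractZr HG; apply/esym/qs_piZ.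
- by rewrite !ta_liftM !ractM HG HH.
Qed.

Lemma qm_rho_repr : right_representation qm_rho.
Proof.
move=> G RG a; apply: endoP; elim/quotW=> x; rewrite qm_rho_ract ract0r.
have [n Hn] := ta_subst_bound G.
pose b i := if i == n then x else a i.
have -> : ta_subst a G = ta_subst b G.
  by apply: Hn => i lt_in; rewrite /b ltn_eqF.
have <- : fn_subst b (fn_var n) = x by rewrite fn_subst_var /b eqxx.
by rewrite -fn_subst_ract RG ract0r fn_subst0 qs_pi0.
Qed.

Definition quotient_module : rightModule A := RightModule qm_rho_repr.

End QuotientModule.

Section QuotientAlgebra.
Variables (F : fieldType) (A : novikovType F) (I : ideal A).

Definition quotient_algebra : Type := qspace I.

HB.instance Definition _ := GRing.Lmodule.on quotient_algebra.
HB.instance Definition _ := EqQuotient.on quotient_algebra.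

Local Notation Q := quotient_algebra.

Definition qa_mul (x y : Q) : Q := \pi_Q (repr x ** repr y).

Lemma qa_piM x y : \pi_Q (x ** y) = qa_mul (\pi_Q x) (\pi_Q y).
Proof.
apply/qs_piP; set x' := repr _; set y' := repr _.
have -> : x ** y - x' ** y' = (x - x') ** y + x' ** (y - y').
  rewrite namulDl namulDr -[- x']scaleN1r -[- y']scaleN1r namulZl namulZr.
  by rewrite !scaleN1r addrA subrK.
by apply: rpredD; [apply: rideal_mul|apply: lideal_mul]; apply/qs_piP; rewrite reprK.
Qed.

Lemma qa_mulDl : left_distributive qa_mul +%R.
Proof.
elim/quotW=> x; elim/quotW=> y; elim/quotW=> z.
by have := congr1 \pi_Q (namulDl x y z); rewrite !(qs_piD, qa_piM).
Qed.
Lemma qa_mulDr : right_distributive qa_mul +%R.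
Proof.
elim/quotW=> x; elim/quotW=> y; elim/quotW=> z.
by have := congr1 \pi_Q (namulDr x y z); rewrite !(qs_piD, qa_piM).
Qed.
Lemma qa_mulZl (c : F) (x y : Q) : qa_mul (c *: x) y = c *: qa_mul x y.
Proof.
elim/quotW: x => x; elim/quotW: y => y.
by have := congr1 \pi_Q (namulZl c x y); rewrite !(qs_piZ, qa_piM).
Qed.
Lemma qa_mulZr (c : F) (x y : Q) : qa_mul x (c *: y) = c *: qa_mul x y.
Proof.
elim/quotW: x => x; elim/quotW: y => y.
by have := congr1 \pi_Q (namulZr c x y); rewrite !(qs_piZ, qa_piM).
Qed.

HB.instance Definition _ :=
  Lmodule_isNAAlgebra.Build F Q qa_mulDl qa_mulDr qa_mulZl qa_mulZr.

End QuotientAlgebra.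

(* [associator_span f] is the subspace [(A, A, f)]. *)

Definition associator_span (F : fieldType) (A : naAlgType F) (f : A) (x : A) : Prop :=
  exists s : seq (F * A * A),
    x = \sum_(t <- s) t.1.1 *: associator t.1.2 t.2 f.

(* Main.v *)
(** The operators of a right Novikov module commute, and the module associator
[(m, a, b) = (m . a) . b - m . (ab)] satisfies [(m, ac, b) = (m, a, b) . c],
because [x (x) y - y (x) x] and the corresponding cubic tensor are
R-identities. Hence [a |-> (m, a, f)] is a module homomorphism from [A] to [M],
as is [a |-> m . a] when [M] is associative. If [M] is irreducible and the
homomorphism is nonzero, it is onto, and [I] is its kernel. In the
nonassociative case, [(A, A, f)] not contained in [I] means that
[b |-> (m, b, f)] is nonzero, hence onto, for some [m] of [M], so
[(m, e, f) = m] for some [e]; since the operators commute, this [e] satisfies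
[(m', e, f) = m'] for all [m'] of [M]. *)
Require Import Defs.
From HB Require Import structures.
From mathcomp Require Import all_boot all_algebra.
From mathcomp Require Import boolp.

Set Implicit Arguments.
Unset Strict Implicit.
Unset Printing Implicit Defensive.

Import GRing.Theory.
Local Open Scope ring_scope.
Local Open Scope quotient_scope.

(** * An associator identity in Novikov algebras *)

Section Novikov.
Variables (F : fieldType) (A : novikovType F).
Implicit Types a b c : A.

Lemma namulNl a b : (- a) ** b = - (a ** b).
Proof. by rewrite -!scaleN1r namulZl. Qed.

Lemma namulBl a b c : (a - b) ** c = a ** c - b ** c.
Proof. by rewrite namulDl namulNl. Qed.

(** Left symmetry brings [a ** b] to the first place; right commutativity then pulls [b] out of both
    terms. *)
Lemma associatorMm a b c g : associator g (a ** b) c = associator g a c ** b.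
Proof.
rewrite novikov_lsym (novikov_lsym g) /associator namulBl.
by rewrite (novikov_rcomm a b g) (novikov_rcomm _ b c) (novikov_rcomm a b).
Qed.

End Novikov.

(** * The module action and its associator *)

Section Module.
Variables (F : fieldType) (A : novikovType F) (M : rightModule A).
Implicit Types (m n : M) (a b c e f : A).

Lemma mactDl m n a : (m + n) <.> a = m <.> a + n <.> a.
Proof. exact: ractDl. Qed.

Lemma mactZl (k : F) m a : (k *: m) <.> a = k *: (m <.> a).
Proof. exact: ractZl. Qed.

Lemma mactBl m n a : (m - n) <.> a = m <.> a - n <.> a.
Proof. by rewrite mactDl -!scaleN1r mactZl. Qed.

Lemma mact0l a : (0 : M) <.> a = 0.
Proof. by rewrite -[X in X <.> _](scale0r 0) mactZl scale0r. Qed.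

Lemma mactDr m a b : m <.> (a + b) = m <.> a + m <.> b.
Proof. by rewrite /mact linearD. Qed.

Lemma mactZr (k : F) m a : m <.> (k *: a) = k *: (m <.> a).
Proof. by rewrite /mact linearZZ. Qed.

Lemma mact_linear m : linear (mact m).
Proof. by move=> k a b; rewrite mactDr mactZr. Qed.

Definition massoc m a b : M := (m <.> a) <.> b - m <.> (a ** b).

End Module.

(** * R-identities and their consequences in modules *)

Section RIdentities.
Variables (F : fieldType) (A : novikovType F) (M : rightModule A).
Implicit Types (m : M) (a b c : A).

Let X i : freeNovikov F := fn_var i.

Let ractB (V : lmodType F) (v : V) (f g : endo V) :
  ract v (f - g) = ract v f - ract v g.
Proof. by []. Qed.

Let ta_liftB (V : lmodType F) (B : uaAlgType F) (phi : {linear V -> B}) x y :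
  ta_lift phi (x - y) = ta_lift phi x - ta_lift phi y.
Proof. exact: (linearB (ta_lift phi : {linear _ -> _})). Qed.

Let ract_rmul (B : naAlgType F) (g f : B) : ract g (rmul f) = g ** f.
Proof. by []. Qed.

(** Placed before [ta_lift_in] in the rewrites below, it yields the substituted value instead of an
    unreduced composite. *)
Let ta_substE (s : seq A) (t : freeNovikov F) :
  ta_lift (ta_in \o fn_subst (nth 0 s) : {linear freeNovikov F -> tensorAlg A})
    (ta_in t) = ta_in (fn_subst (nth 0 s) t).
Proof. by rewrite ta_lift_in. Qed.

Lemma mactC m a b : (m <.> a) <.> b = (m <.> b) <.> a.
Proof.
pose G : tensorAlg (freeNovikov F) :=
  ta_in (X 0) ** ta_in (X 1) - ta_in (X 1) ** ta_in (X 0).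
have RG : R_identity G.
  apply: endoP => g; rewrite ta_liftB !ta_liftM !ta_lift_in ract0r.
  by rewrite ractB !ractM !ract_rmul novikov_rcomm subrr.
(* Variables beyond the list are sent to [0]; none of them occurs in [G]. *)
have /(congr1 (ract m)) := rmod_repr M RG (nth 0 [:: a; b]).
rewrite /ta_subst !(ta_liftB, ta_liftM, ta_substE, ta_lift_in, fn_subst_var).
by rewrite ract0r ractB !ractM => /eqP; rewrite subr_eq0 => /eqP.
Qed.

Lemma massocMm m a b c : massoc m (a ** b) c = massoc m a c <.> b.
Proof.
pose G : tensorAlg (freeNovikov F) :=
  (ta_in (X 0 ** X 1) ** ta_in (X 2) - ta_in ((X 0 ** X 1) ** X 2))
  - (ta_in (X 0) ** ta_in (X 2) - ta_in (X 0 ** X 2)) ** ta_in (X 1).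
have RG : R_identity G.
  apply: endoP => g; rewrite !(ta_liftB, ta_liftM, ta_lift_in) ract0r.
  rewrite !(ractB, ractM, ract_rmul).
  by apply/eqP; rewrite subr_eq0; apply/eqP/associatorMm.
have /(congr1 (ract m)) := rmod_repr M RG (nth 0 [:: a; b; c]).
rewrite /ta_subst.
rewrite !(ta_liftB, ta_liftM, ta_substE, ta_lift_in, fn_substM, fn_subst_var).
by rewrite ract0r !(ractB, ractM) => /eqP; rewrite subr_eq0 => /eqP.
Qed.

(** The operator [massoc _ a b] is built from action operators, which commute with the action of
    [c]. *)
Lemma massoc_mact m a b c : massoc (m <.> c) a b = massoc m a b <.> c.
Proof.
by rewrite /massoc mactBl (mactC m c a) (mactC _ c b) (mactC m c).
Qed.

Lemma massoc_linear_l a b : linear (fun m => massoc m a b).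
Proof.
move=> k m n; rewrite /massoc !(mactDl, mactZl) scalerBr opprD.
by rewrite addrACA.
Qed.

Lemma massoc_linear_m m b : linear (fun a => massoc m a b).
Proof.
move=> k a c; rewrite /massoc namulDl namulZl !(mactDr, mactZr, mactDl, mactZl).
by rewrite scalerBr opprD addrACA.
Qed.

End RIdentities.

(** * Module homomorphisms out of [A], kernels and ideals *)

Section ModuleHom.
Variables (F : fieldType) (A : novikovType F) (M : rightModule A).

Definition module_hom (phi : A -> M) : Prop :=
  linear phi /\ forall a c, phi (a ** c) = phi a <.> c.

Lemma module_hom_massoc (m : M) (f : A) : module_hom (fun a => massoc m a f).
Proof. by split=> [|a c]; [apply: massoc_linear_m|apply: massocMm]. Qed.

(** Turns a propositional description, such as a kernel, into a bundled ideal by deciding membership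
    classically. *)
Lemma exists_rightIdeal (P : A -> Prop) :
  P 0 -> (forall k x y, P x -> P y -> P (k *: x + y)) ->
  (forall x a, P x -> P (x ** a)) ->
  exists I : rightIdeal A, forall x, x \in I <-> P x.
Proof.
move=> P0 PD PM; pose S : {pred A} := [pred x | `[< P x >]].
have S_closed : GRing.submod_closed S.
  split=> [|k x y]; rewrite !inE; first exact/asboolP.
  by move=> /asboolP Px /asboolP Py; apply/asboolP/PD.
have S_mul x a : x \in S -> x ** a \in S.
  by rewrite !inE => /asboolP Px; apply/asboolP/PM.
pose I : rightIdeal A := HB.pack S (GRing.isSubmodClosed.Build F A S S_closed)
  (isRightIdeal.Build F A S S_mul).
by exists I => x; rewrite inE; split=> /asboolP.
Qed.

Lemma exists_ideal (P : A -> Prop) :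
  P 0 -> (forall k x y, P x -> P y -> P (k *: x + y)) ->
  (forall x a, P x -> P (x ** a)) -> (forall x a, P x -> P (a ** x)) ->
  exists I : ideal A, forall x, x \in I <-> P x.
Proof.
move=> P0 PD PM PM'; have [J JP] := exists_rightIdeal P0 PD PM.
have J_mul a x : x \in J -> a ** x \in J by rewrite !JP; apply: PM'.
pose I : ideal A := HB.pack (RightIdeal.sort J) (RightIdeal.on J)
  (isLeftIdeal.Build F A J J_mul).
by exists I.
Qed.

Section Hom.
Variables (phi : A -> M) (phiP : module_hom phi).

Let phiL : {linear A -> M} :=
  HB.pack phi (GRing.isLinear.Build F A M *:%R phi (proj1 phiP)).

Lemma module_hom0 : phi 0 = 0.
Proof. exact: (linear0 phiL). Qed.

Lemma module_homB : {morph phi : x y / x - y}.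
Proof. exact: (linearB phiL). Qed.

Lemma module_hom_ker :
  exists I : rightIdeal A, forall x, x \in I <-> phi x = 0.
Proof.
case: phiP => phi_lin phiM; apply: exists_rightIdeal => [|k x y|x a phix].
- exact: module_hom0.
- by rewrite phi_lin => -> ->; rewrite scaler0 addr0.
- by rewrite phiM phix mact0l.
Qed.

Variable I : rightIdeal A.
Hypothesis IP : forall x, x \in I <-> phi x = 0.

(** The isomorphism sends [m] to the class of a chosen preimage; two preimages differ by an element
    of the kernel [I]. *)
Lemma module_hom_iso : (forall m, exists a, phi a = m) ->
  module_iso M (quotient_module I).
Proof.
move=> /choice[g gK].
have phi_eq a b : phi a = phi b -> \pi_(qspace I) a = \pi_(qspace I) b.
  by move=> ab; apply/qs_piP/IP; rewrite module_homB ab subrr.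
pose psi m := \pi_(qspace I) (g m).
have psi_lin : linear psi.
  move=> k m n; rewrite /psi -qs_pi_linear; apply: phi_eq.
  by rewrite (proj1 phiP) !gK.
pose psiL : {linear M -> quotient_module I} :=
  HB.pack psi (GRing.isLinear.Build F M (qspace I) *:%R psi psi_lin).
exists psiL => [|m a].
  exists (fun q : qspace I => phi (repr q)) => [m|q].
    rewrite -{2}[m]gK; apply/eqP; rewrite -subr_eq0 -module_homB.
    by apply/eqP/IP/qs_piP; rewrite reprK.
  by rewrite -[RHS]reprK; apply: phi_eq; rewrite gK.
transitivity (\pi_(qspace I) (g m ** a)); last exact/esym/qm_actE.
by apply: phi_eq; rewrite (proj2 phiP) !gK.
Qed.

End Hom.

(** * Consequences of irreducibility *)

Hypothesis irrM : irreducible_module M.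

(** Irreducibility as an induction principle: [P] defines a nonzero submodule, hence all of [M]. *)
Lemma irreducible_submodule (P : M -> Prop) :
  P 0 -> (forall k m n, P m -> P n -> P (k *: m + n)) ->
  (forall m a, P m -> P (m <.> a)) -> (exists2 m, P m & m <> 0) ->
  forall m, P m.
Proof.
move=> P0 PD PM [m0 Pm0 nz]; pose S : {pred M} := [pred x | `[< P x >]].
have S_closed : GRing.submod_closed S.
  split=> [|k x y]; rewrite !inE; first exact/asboolP.
  by move=> /asboolP Px /asboolP Py; apply/asboolP/PD.
pose W : submodClosed M := HB.pack S (GRing.isSubmodClosed.Build F M S S_closed).
case: (proj1 irrM W) => [m a /asboolP Pm|W0|WT m].
- exact/asboolP/PM.
- by case: nz; apply: W0; apply/asboolP.
- exact/asboolP/(WT m).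
Qed.

(** The elements annihilated by [A] form a submodule, which is not all of [M] and so is zero. *)
Lemma irreducible_act (m : M) : m <> 0 -> exists a, m <.> a <> 0.
Proof.
move=> nz; apply: contrapT => /forallNP m0.
case: (proj2 irrM) => n [b]; apply; move: n b.
apply: (irreducible_submodule (P := fun m => forall a, m <.> a = 0)).
- exact: mact0l.
- by move=> k x y x0 y0 a; rewrite mactDl mactZl x0 y0 scaler0 addr0.
- by move=> x a x0 b; rewrite x0 mact0l.
- by exists m => // a; apply: contrapT => /m0.
Qed.

Section IrreducibleHom.
Variables (phi : A -> M) (phiP : module_hom phi).

(** The image of [J] is a nonzero submodule. The case of [J] all of [A] gives surjectivity; [J]
    larger than the kernel gives maximality. *)
Lemma module_hom_image (J : rightIdeal A) :
  (exists2 a, a \in J & phi a <> 0) -> forall m, exists2 a, a \in J & phi a = m.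
Proof.
case=> a Ja nz; apply: irreducible_submodule.
- by exists 0; [apply: rpred0|exact: module_hom0 phiP].
- move=> k _ _ [x Jx <-] [y Jy <-]; exists (k *: x + y); last exact: (proj1 phiP).
  by apply: rpredD => //; apply: rpredZ.
- by move=> _ b [x Jx <-]; exists (x ** b); [apply: rideal_mul|apply: (proj2 phiP)].
- by exists (phi a) => //; exists a.
Qed.

Lemma module_hom_onto a : phi a <> 0 -> forall m, exists a, phi a = m.
Proof.
move=> nz m; have [|||J JP] := @exists_rightIdeal (fun=> True); try by [].
by have [|b _ <-] := @module_hom_image J _ m; [exists a; [apply/JP|]|exists b].
Qed.

Lemma module_hom_maximal (I : rightIdeal A) a :
  (forall x, x \in I <-> phi x = 0) -> phi a <> 0 -> maximal_right_ideal I.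
Proof.
move=> IP nz; split; first by exists a; apply/negP => /IP.
move=> J [z /negP Jz] IJ x Jx; apply/IP; apply: contrapT => nx; apply: Jz.
have [|y Jy yz] := @module_hom_image J _ (phi z); first by exists x.
(* As [z - y] lies in the kernel [I], hence in [J], so does [z], against its choice. *)
rewrite -(subrK y z); apply: rpredD => //; apply/IJ/IP.
by rewrite module_homB // yz subrr.
Qed.

End IrreducibleHom.

(** Surjectivity gives [e] with [massoc m e f = m]; the fixed points of the endomorphism
    [massoc _ e f] form a submodule containing the nonzero [m]. *)
Lemma massoc_unit (m : M) a f : massoc m a f <> 0 ->
  exists e, forall n : M, massoc n e f = n.
Proof.
move=> nz.
have [e me] := module_hom_onto (module_hom_massoc m f) nz m.
exists e; apply: irreducible_submodule.
- by rewrite /massoc !mact0l subrr.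
- by move=> k x y xe ye; rewrite massoc_linear_l xe ye.
- by move=> x b xe; rewrite massoc_mact xe.
- by exists m => // m0; apply: nz; rewrite m0 /massoc !mact0l subrr.
Qed.

Lemma module_hom_associator (phi : A -> M) a e f : module_hom phi ->
  phi (associator a e f) = massoc (phi a) e f.
Proof. by move=> phiP; rewrite /associator module_homB // !(proj2 phiP). Qed.

(** * The associative case *)

Lemma associative_irreducible : associative_module M ->
  exists I : ideal A,
    [/\ maximal_ideal I, is_field (quotient_algebra I) &
        module_iso M (quotient_module I)].
Proof.
move=> assM.
have mactA (m : M) a b : m <.> (a ** b) = (m <.> a) <.> b.
  by apply/esym/eqP; rewrite -subr_eq0; apply/eqP/assM.
have homM (m : M) : module_hom (mact m) by split; [apply: mact_linear|].
have [m [a0 ma0]] := proj2 irrM.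
have m0 : m <> 0 by move=> m0; apply: ma0; rewrite m0 mact0l.
have [||||I IP] := @exists_ideal (fun a => m <.> a = 0).
- exact: (module_hom0 (homM m)).
- by move=> k x y mx my; rewrite mact_linear mx my scaler0 addr0.
- by move=> x a mx; rewrite mactA mx mact0l.
(* The kernel is also a left ideal: [m <.> (a ** x) = (m <.> x) <.> a]. *)
- by move=> x a mx; rewrite mactA mactC mx mact0l.
(* The class of [u] will be the identity of the quotient. *)
have [u mu] := module_hom_onto (homM m) ma0 m.
have inv x : x \notin I -> exists y, m <.> (x ** y) = m.
  move=> /negP Ix; have mx : m <.> x <> 0 by move/IP.
  (* The nonzero [m <.> x] generates [M], so some [y] carries it back to [m]. *)
  have [b mxb] := irreducible_act mx.
  have [y myx] := module_hom_onto (homM _) mxb m.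
  by exists y; rewrite mactA.
have qeq x y : m <.> x = m <.> y ->
    \pi_(quotient_algebra I) x = \pi_(quotient_algebra I) y.
  by move=> xy; apply/qs_piP/IP; rewrite (module_homB (homM m)) xy subrr.
have piM x y : \pi_(quotient_algebra I) x ** \pi_(quotient_algebra I) y =
    \pi_(quotient_algebra I) (x ** y) by rewrite qa_piM.
exists I; split.
- split; first by exists a0; apply/negP => /IP.
  move=> J [z /negP Jz] IJ x Jx; apply: contrapT => /negP Ix; apply: Jz.
  have [y mxy] := inv x Ix.
  (* Modulo [I], [x ** y] is a left identity, so [z] agrees there with an element of [J]. *)
  rewrite -(subrK (x ** y ** z) z); apply: rpredD.
    by apply/IJ/IP; rewrite (module_homB (homM m)) (mactA m) mxy subrr.
  by do 2! apply: rideal_mul.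
- split=> [||].
  + elim/quotW=> x; elim/quotW=> y.
    by rewrite !piM; apply: qeq; rewrite !mactA mactC.
  + elim/quotW=> x; elim/quotW=> y; elim/quotW=> z.
    (* [!piM] would also match a product of classes, as a class of representatives. *)
    by rewrite (piM y z) (piM x y) (piM x) (piM _ z); apply: qeq; rewrite !mactA.
  + exists (\pi u); split.
    * by move/qs_pi_eq0/IP; rewrite mu.
    * elim/quotW=> x.
      by rewrite !piM; apply: qeq; rewrite mactA mu.
    * elim/quotW=> x x0; have [|y mxy] := inv x.
        by apply/negP => Ix; apply: x0; apply/qs_pi_eq0.
      by exists (\pi y); rewrite !piM; apply: qeq; rewrite mxy.
- exact: (module_hom_iso (homM m) IP (module_hom_onto (homM m) ma0)).
Qed.

(** * The nonassociative case *)

Lemma nonassociative_irreducible : ~ associative_module M ->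
  exists I : rightIdeal A,
    [/\ maximal_right_ideal I, module_iso M (quotient_module I),
        (exists e f : A, forall a : A, a - associator a e f \in I) &
        forall f : A, ~ (forall x : A, associator_span f x -> x \in I) ->
          exists e : A, forall a : A, a - associator a e f \in I].
Proof.
move=> /existsNP[m] /existsNP[b] /existsNP[f]; rewrite -/(massoc m b f) => nz.
have phiP := module_hom_massoc m f.
have [I IP] := module_hom_ker phiP.
(* Here [phi] sends [a - associator a e g] to [phi a - massoc (phi a) e g]; [g] need not be the [f]
   that defines [I]. *)
have unit_ker e g : (forall n : M, massoc n e g = n) ->
    forall a, a - associator a e g \in I.
  move=> eg a; apply/IP.
  by rewrite (module_homB phiP) (module_hom_associator _ _ _ phiP) eg subrr.
exists I; split.
- exact: module_hom_maximal phiP _ _ IP nz.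
- exact: (module_hom_iso phiP IP (module_hom_onto phiP nz)).
- by have [e eP] := massoc_unit nz; exists e, f; apply: unit_ker.
(* Otherwise every generator [associator a c g] of the span would lie in the kernel [I]. *)
- move=> g gI; have [a [c nz']] : exists a c, massoc (massoc m a f) c g <> 0.
    apply: contrapT => /forallNP all0; apply: gI => _ [s ->].
    apply: rpred_sum => -[[k a] c] _; apply/rpredZ/IP => /=.
    rewrite (module_hom_associator _ _ _ phiP).
    by apply: contrapT => ?; case: (all0 a); exists c.
  by have [e eP] := massoc_unit nz'; exists e; apply: unit_ker.
Qed.

End ModuleHom.

Theorem lemma3p2 (F : fieldType) (charF : 2%N \notin [pchar F])
    (A : novikovType F) (M : rightModule A) (irrM : irreducible_module M) :
  (associative_module M /\
   exists I : ideal A,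
     [/\ maximal_ideal I, is_field (quotient_algebra I) &
         module_iso M (quotient_module I)])
  \/
  (~ associative_module M /\
   exists I : rightIdeal A,
     [/\ maximal_right_ideal I, module_iso M (quotient_module I),
         (exists e f : A, forall a : A, a - associator a e f \in I) &
         forall f : A, ~ (forall x : A, associator_span f x -> x \in I) ->
           exists e : A, forall a : A, a - associator a e f \in I]).
Proof.
have [assM|nassM] := EM (associative_module M); [left|right]; split=> //.
  exact: associative_irreducible.
exact: nonassociative_irreducible.
Qed.
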